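(* Let $\mathscr{G}$ be a quiver skew brace, let $(\Lambda,\langle -,-,-\rangle)$ be a heap, and let $\triangleright$ be an action of the coarse groupoid $\widehat{\Lambda}$ on the groupoid $\mathscr{G}$. On the semidirect product of groupoids $\mathscr{G}\rtimes_\triangleright\widehat{\Lambda}$, define an additive structure by \[ (g\times[a,b])+_a(h\times[a,c])=(g+_\lambda h)\times[a,\langle b,a,c\rangle] \] for $\lambda\in\mathscr{G}^0$, $g,h\in\mathrm{St}_{\mathscr{G}}(\lambda)$, $a,b,c\in\Lambda$. This is a quiver skew brace structure on $\mathscr{G}\rtimes_\triangleright\widehat{\Lambda}$ if and only if the bundle of additive star-groups $\bigsqcup_{\lambda\in\mathscr{G}^0}\mathrm{St}_{\mathscr{G}}(\lambda)$ is a $\widehat{\Lambda}$-module algebra, i.e. $[a,b]\triangleright(h+k)=[a,b]\triangleright h+[a,b]\triangleright k$ for all $a,b\in\Lambda$, $\lambda\in\mathscr{G}^0$, $h,k\in\mathrm{St}_{\mathscr{G}}(\lambda)$.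
   Context: A groupoid $\mathscr{G}$ has arrows $\mathscr{G}^1$, vertices $\mathscr{G}^0$, source and target maps $\mathfrak{s},\mathfrak{t}$; $xy$ is defined when $\mathfrak{t}(x)=\mathfrak{s}(y)$. The star at $\lambda$ is $\mathrm{St}_{\mathscr{G}}(\lambda)=\{x\in\mathscr{G}^1:\mathfrak{s}(x)=\lambda\}$. A quiver skew brace is a groupoid $(\mathscr{G},\cdot)$ with, for every $\lambda\in\mathscr{G}^0$, a (not necessarily abelian) group operation $+_\lambda$ on $\mathrm{St}_{\mathscr{G}}(\lambda)$ such that $a(b+_{\mathfrak{t}(a)}c)=ab-_{\mathfrak{s}(a)}a+_{\mathfrak{s}(a)}ac$ whenever $\mathfrak{t}(a)=\mathfrak{s}(b)=\mathfrak{s}(c)$. A heap is a set with a ternary operation satisfying $\langle\langle a,b,c\rangle,d,e\rangle=\langle a,b,\langle c,d,e\rangle\rangle$, $\langle a,b,b\rangle=a$ and $\langle a,a,b\rangle=b$. The coarse groupoid $\widehat{\Lambda}$ has vertex set $\Lambda$ and exactly one arrow $[a,b]\colon a\to b$ for all $a,b\in\Lambda$. An action of $\widehat{\Lambda}$ on the groupoid $\mathscr{G}$ assigns to each $[a,b]$ an automorphism $[a,b]\triangleright(-)$ of the groupoid $(\mathscr{G},\cdot)$ (acting on arrows and on vertices), such that $[a,a]\triangleright x=x$ and $[a,b]\triangleright([b,c]\triangleright x)=[a,c]\triangleright x$. The semidirect product of groupoids $\mathscr{G}\rtimes_\triangleright\widehat{\Lambda}$ has set of arrows $\mathscr{G}^1\times\widehat{\Lambda}^1$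 (elements written $g\times[a,b]$), set of vertices $\mathscr{G}^0\times\Lambda$, source $\mathfrak{s}(g)\times a$ and target $([b,a]\triangleright\mathfrak{t}(g))\times b$ for $g\times[a,b]$, multiplication $(g\times[a,b])(h\times[b,c])=g([a,b]\triangleright h)\times[a,c]$, and units $1_{\lambda}\times[a,a]$. Thus the star at $(\lambda,a)$ is $\{g\times[a,b]: g\in\mathrm{St}_{\mathscr{G}}(\lambda), b\in\Lambda\}$. *)

(* Defs.v *)
From mathcomp Require Import ssreflect ssrfun ssrbool.
From Stdlib Require Import ProofIrrelevance.

Set Implicit Arguments.
Unset Strict Implicit.
Unset Printing Implicit Defensive.

(* Composition is in diagrammatic order: [mul x y] needs [tgt x = src y]. *)
Record groupoid : Type := Groupoid {
  vert : Type;
  arr : Type;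
  src : arr -> vert;
  tgt : arr -> vert;
  mul : forall x y : arr, tgt x = src y -> arr;
  unit_arr : vert -> arr;
  inv_arr : arr -> arr;
  src_mul : forall x y (h : tgt x = src y), src (mul h) = src x;
  tgt_mul : forall x y (h : tgt x = src y), tgt (mul h) = tgt y;
  src_unit : forall v, src (unit_arr v) = v;
  tgt_unit : forall v, tgt (unit_arr v) = v;
  src_inv : forall x, src (inv_arr x) = tgt x;
  tgt_inv : forall x, tgt (inv_arr x) = src x;
  mul_assoc : forall x y z (hxy : tgt x = src y) (hyz : tgt y = src z)
      (hl : tgt (mul hxy) = src z) (hr : tgt x = src (mul hyz)),
    mul hl = mul hr;
  mul_unit_l : forall x (h : tgt (unit_arr (src x)) = src x), mul h = x;
  mul_unit_r : forall x (h : tgt x = src (unit_arr (tgt x))), mul h = x;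
  mul_inv_l : forall x (h : tgt (inv_arr x) = src x),
    mul h = unit_arr (tgt x);
  mul_inv_r : forall x (h : tgt x = src (inv_arr x)),
    mul h = unit_arr (src x)
}.

Arguments src {g} _.
Arguments tgt {g} _.
Arguments mul {g} x y _.
Arguments unit_arr {g} _.
Arguments inv_arr {g} _.

Definition star (G : groupoid) (l : vert G) : Type := {x : arr G | src x = l}.

Definition self_star (G : groupoid) (a : arr G) : star (src a) :=
  exist _ a erefl.

Definition mul_star (G : groupoid) (a : arr G) (b : star (tgt a)) :
    star (src a) :=
  exist _ (mul a (sval b) (esym (svalP b))) (src_mul _).

Definition group_laws (T : Type) (op : T -> T -> T) (e : T) (opp : T -> T) :
    Prop :=
  [/\ associative op, left_id e op, right_id e op,
      left_inverse e opp op & right_inverse e opp op].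

Definition star_op (G : groupoid) : Type :=
  forall l : vert G, star l -> star l -> star l.

(* The neutral elements [zero] and the opposites [opp] are uniquely determined
   by [add], so that being a quiver skew brace is a property of [add]. *)
Definition is_quiver_skew_brace (G : groupoid) (add : star_op G) : Prop :=
  exists (zero : forall l : vert G, star l)
         (opp : forall l : vert G, star l -> star l),
    (forall l, group_laws (add l) (zero l) (opp l)) /\
    (forall (a : arr G) (b c : star (tgt a)),
       mul_star (add (tgt a) b c) =
       add (src a)
         (add (src a) (mul_star b) (opp (src a) (self_star a)))
         (mul_star c)).

Record quiver_skew_brace : Type := QuiverSkewBrace {
  qsb_groupoid :> groupoid;
  qsb_add : star_op qsb_groupoid;
  qsb_axioms : is_quiver_skew_brace qsb_add
}.

Arguments qsb_add q {l} _ _.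

Record heap : Type := Heap {
  heap_sort :> Type;
  heap_op : heap_sort -> heap_sort -> heap_sort -> heap_sort;
  heap_assoc : forall a b c d e,
    heap_op (heap_op a b c) d e = heap_op a b (heap_op c d e);
  heap_right : forall a b, heap_op a b b = a;
  heap_left : forall a b, heap_op a a b = b
}.

Arguments heap_op {h} _ _ _.

Section CoarseGroupoid.
Variable L : Type.

(* The unique arrow [a -> b] is the pair [(a, b)]. *)
Definition coarse : groupoid.
Proof.
refine (@Groupoid L (L * L)%type fst snd (fun x y _ => (x.1, y.2))
  (fun a => (a, a)) (fun x => (x.2, x.1)) _ _ _ _ _ _ _ _ _ _ _) => //=.
- by case.
- by case.
Defined.

End CoarseGroupoid.

Record groupoid_aut (G : groupoid) : Type := GroupoidAut {
  aut_vert : vert G -> vert G;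
  aut_arr : arr G -> arr G;
  aut_vert_bij : bijective aut_vert;
  aut_arr_bij : bijective aut_arr;
  aut_src : forall x, src (aut_arr x) = aut_vert (src x);
  aut_tgt : forall x, tgt (aut_arr x) = aut_vert (tgt x);
  aut_mul : forall x y (h : tgt x = src y)
      (h' : tgt (aut_arr x) = src (aut_arr y)),
    aut_arr (mul x y h) = mul (aut_arr x) (aut_arr y) h'
}.

Definition aut_star (G : groupoid) (f : groupoid_aut G) (l : vert G)
    (x : star l) : star (aut_vert f l) :=
  exist _ (aut_arr f (sval x)) (etrans (aut_src f _) (congr1 _ (svalP x))).

Record coarse_action (L : Type) (G : groupoid) : Type := CoarseAction {
  act :> arr (coarse L) -> groupoid_aut G;
  act_vert_id : forall a v, aut_vert (act (a, a)) v = v;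
  act_arr_id : forall a x, aut_arr (act (a, a)) x = x;
  act_vert_comp : forall a b c v,
    aut_vert (act (a, b)) (aut_vert (act (b, c)) v) = aut_vert (act (a, c)) v;
  act_arr_comp : forall a b c x,
    aut_arr (act (a, b)) (aut_arr (act (b, c)) x) = aut_arr (act (a, c)) x
}.

Lemma mul_congr (G : groupoid) (x x' y y' : arr G)
    (h : tgt x = src y) (h' : tgt x' = src y') :
  x = x' -> y = y' -> mul x y h = mul x' y' h'.
Proof.
by move=> ex ey; subst x' y'; rewrite (proof_irrelevance _ h h').
Qed.

Lemma aut_unit (G : groupoid) (f : groupoid_aut G) v :
  aut_arr f (unit_arr v) = unit_arr (aut_vert f v).
Proof.
set u := aut_arr f _.
have su : src u = aut_vert f v by rewrite aut_src src_unit.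
have tu : tgt u = aut_vert f v by rewrite aut_tgt tgt_unit.
have h0 : tgt (unit_arr v) = src (unit_arr v) by rewrite tgt_unit src_unit.
have huu : tgt u = src u by rewrite su tu.
have uu : mul u u huu = u.
  rewrite -(aut_mul h0); congr (aut_arr f _).
  have e : unit_arr (src (unit_arr v)) = unit_arr v by rewrite src_unit.
  rewrite -[RHS](mul_unit_l (etrans (tgt_unit _) erefl)).
  exact: mul_congr.
have hu : tgt (inv_arr u) = src u := tgt_inv u.
have hr : tgt (inv_arr u) = src (mul u u huu) by rewrite uu.
have hl : tgt (mul (inv_arr u) u hu) = src u by rewrite tgt_mul.
have e : mul (inv_arr u) u hu = unit_arr (src u) by rewrite mul_inv_l huu.
have hs : tgt (unit_arr (src u)) = src u by rewrite tgt_unit.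
by rewrite -[u](mul_unit_l hs) -(mul_congr hl hs e erefl) (mul_assoc hl hr)
  (mul_congr hr hu erefl uu) mul_inv_l tu.
Qed.

Section Semidirect.
Variables (G : groupoid) (L : Type) (act : coarse_action L G).

Definition sd_vert : Type := (vert G * L)%type.
Definition sd_arr : Type := (arr G * arr (coarse L))%type.

Definition sd_src (x : sd_arr) : sd_vert := (src x.1, src x.2).
Definition sd_tgt (x : sd_arr) : sd_vert :=
  (aut_vert (act (inv_arr x.2)) (tgt x.1), tgt x.2).

Lemma sd_mul_arr_proof (x y : sd_arr) :
  sd_tgt x = sd_src y -> tgt x.1 = src (aut_arr (act x.2) y.1).
Proof.
case: x y => [g [a b]] [h [b' c]] [/= e _].
by rewrite aut_src -e act_vert_comp act_vert_id.
Qed.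

Lemma sd_mul_coarse_proof (x y : sd_arr) :
  sd_tgt x = sd_src y -> tgt x.2 = src y.2.
Proof. by case. Qed.

Definition sd_mul (x y : sd_arr) (h : sd_tgt x = sd_src y) : sd_arr :=
  (mul x.1 (aut_arr (act x.2) y.1) (sd_mul_arr_proof h),
   mul x.2 y.2 (sd_mul_coarse_proof h)).

Definition sd_unit (v : sd_vert) : sd_arr :=
  (unit_arr v.1, @unit_arr (coarse L) v.2).

Definition sd_inv (x : sd_arr) : sd_arr :=
  (aut_arr (act (inv_arr x.2)) (inv_arr x.1), inv_arr x.2).

Definition semidirect : groupoid.
Proof.
refine (@Groupoid sd_vert sd_arr sd_src sd_tgt sd_mul sd_unit sd_inv
  _ _ _ _ _ _ _ _ _ _ _).
- by move=> x y h; rewrite /sd_src /= src_mul.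
- move=> [g [a b]] [h [b' c]] e; have [/= _ eb] := e; subst b'.
  by rewrite /sd_tgt /= tgt_mul aut_tgt act_vert_comp.
- by case=> l a; rewrite /sd_src /= src_unit.
- by case=> l a; rewrite /sd_tgt /= tgt_unit act_vert_id.
- by case=> g [a b]; rewrite /sd_src /sd_tgt /= aut_src src_inv.
- by case=> g [a b];
    rewrite /sd_src /sd_tgt /= aut_tgt tgt_inv act_vert_comp act_vert_id.
- move=> [g [a b]] [h [b' c]] [k [c' d]] hxy hyz hl hr.
  have [/= e1 eb] := hxy; have [/= e2 ec] := hyz; subst b' c'.
  rewrite /sd_mul; congr pair.
  have h2 := sd_mul_arr_proof hyz; simpl in h2.
  have h3 : tgt (aut_arr (act (a, b)) h)
          = src (aut_arr (act (a, b)) (aut_arr (act (b, c)) k)).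
    by rewrite aut_tgt [RHS]aut_src h2.
  have e : aut_arr (act (a, b)) (mul h _ h2) = mul _ _ h3 by exact: aut_mul.
  have h4 : tgt g = src (mul _ _ h3).
    by rewrite src_mul; exact: (sd_mul_arr_proof hxy).
  have h5 : tgt (mul g _ (sd_mul_arr_proof hxy))
          = src (aut_arr (act (a, b)) (aut_arr (act (b, c)) k)).
    by rewrite tgt_mul.
  transitivity (mul _ _ h5).
    by apply: mul_congr => //=; rewrite act_arr_comp.
  rewrite (mul_assoc h5 h4); apply: mul_congr => //=.
  by rewrite -e; congr (aut_arr _ _); apply: mul_congr.
- move=> [g [a b]] h; rewrite /sd_mul /=; congr pair.
  rewrite -[RHS](mul_unit_l (tgt_unit _)).
  by apply: mul_congr => //; rewrite act_arr_id.
- move=> [g [a b]] h; rewrite /sd_mul /=; congr pair.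
  rewrite -[RHS](mul_unit_r (esym (src_unit _))).
  by apply: mul_congr => //; rewrite aut_unit act_vert_comp act_vert_id.
- move=> [g [a b]] h; rewrite /sd_mul /sd_unit /=; congr pair.
  rewrite -aut_unit -(mul_inv_l (tgt_inv _)).
  by rewrite aut_mul ?aut_src ?aut_tgt ?tgt_inv // => h'; apply: mul_congr.
- move=> [g [a b]] h; rewrite /sd_mul /sd_unit /=; congr pair.
  rewrite -(mul_inv_r (esym (src_inv _))).
  by apply: mul_congr => //; rewrite act_arr_comp act_arr_id.
Defined.

Definition sd_star (l : vert G) (g : star l) (a b : L) :
    @star semidirect (l, a) :=
  exist (fun x : arr semidirect => src x = (l, a)) (sval g, (a, b))
    (congr1 (fun v => (v, a)) (svalP g)).

Definition sd_star_arr (v : vert semidirect) (x : star v) : star v.1 :=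
  exist _ (sval x).1 (congr1 fst (svalP x)).

Definition sd_star_end (v : vert semidirect) (x : star v) : L := (sval x).2.2.

End Semidirect.

Definition semidirect_add (G : quiver_skew_brace) (L : heap)
    (act : coarse_action L G) : star_op (semidirect act) :=
  fun v =>
    match v return let S := @star (semidirect act) v in S -> S -> S with
    | (l, a) => fun x y =>
        sd_star act (qsb_add G (sd_star_arr x) (sd_star_arr y))
          a (heap_op (sd_star_end x) a (sd_star_end y))
    end.

Arguments semidirect_add {G L} act l _ _.

Lemma semidirect_addE (G : quiver_skew_brace) (L : heap)
    (act : coarse_action L G) (l : vert G) (g h : star l) (a b c : L) :
  semidirect_add act (l, a) (sd_star act g a b) (sd_star act h a c) =
  sd_star act (qsb_add G g h) a (heap_op b a c).
Proof.
have starK (k : star l) d : sd_star_arr (sd_star act k a d) = k.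
  by case: k => k hk; rewrite /sd_star_arr /=; congr exist;
    exact: proof_irrelevance.
by rewrite /semidirect_add !starK.
Qed.

Definition is_module_algebra (L : Type) (G : groupoid)
    (act : coarse_action L G) (add : star_op G) : Prop :=
  forall (a b : L) (l : vert G) (h k : star l),
    aut_star (act (a, b)) (add l h k) =
    add _ (aut_star (act (a, b)) h) (aut_star (act (a, b)) k).

(* Main.v *)
(* The additive law of the semidirect product is componentwise, and the heap
   identity <c, b, d> = <<c, a, <a, b, a>>, a, d> makes its brace law automatic in
   the second component. In the first component, the brace law of G turns the
   right-hand side for A = g x [a, b] into g ([a,b]|>h + [a,b]|>k); cancelling
   g leaves the additivity of [a,b]|>-. Every h, k arise in this way, with
   g a unit. *)
From mathcomp Require Import ssreflect ssrfun ssrbool.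
From Stdlib Require Import ProofIrrelevance.
Require Import Defs.

Set Implicit Arguments.
Unset Strict Implicit.
Unset Printing Implicit Defensive.

Lemma group_laws_opp_uniq (T : Type) (op : T -> T -> T) (e : T) (opp : T -> T) x y :
  group_laws op e opp -> op x y = e -> y = opp x.
Proof.
by case=> opA op0 opr0 opN _ xy; rewrite -[y]op0 -(opN x) -opA xy opr0.
Qed.

Lemma group_morph_zero (T T' : Type) (op : T -> T -> T) (e : T) (opp : T -> T)
    (op' : T' -> T' -> T') (e' : T') (opp' : T' -> T') (f : T -> T') :
  group_laws op e opp -> group_laws op' e' opp' ->
  (forall x y, f (op x y) = op' (f x) (f y)) -> f e = e'.
Proof.
move=> [_ op0 _ _ _] [opA' op0' _ opN' _] fD.
have := congr1 (op' (opp' (f e))) (fD e e).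
by rewrite op0 opN' opA' opN' op0'.
Qed.

Lemma group_morph_opp (T T' : Type) (op : T -> T -> T) (e : T) (opp : T -> T)
    (op' : T' -> T' -> T') (e' : T') (opp' : T' -> T') (f : T -> T') :
  group_laws op e opp -> group_laws op' e' opp' ->
  (forall x y, f (op x y) = op' (f x) (f y)) ->
  forall x, f (opp x) = opp' (f x).
Proof.
move=> gT gT' fD x; apply: (group_laws_opp_uniq gT').
by rewrite -fD; case: (gT) => _ _ _ _ ->; exact: (group_morph_zero gT gT').
Qed.

Section HeapGroup.
Variables (L : heap) (a : L).

(** This is the retract of the heap at the base point [a]. *)
Lemma heap_group_laws :
  group_laws (fun b c => heap_op b a c) a (fun b => heap_op a b a).
Proof.
split=> [b c d|b|b|b|b].
- by rewrite heap_assoc.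
- exact: heap_left.
- exact: heap_right.
- by rewrite heap_assoc heap_left heap_right.
- by rewrite -heap_assoc heap_right heap_left.
Qed.

(** In the retract at [a] the left-hand side is c - b + d, and [a] cancels: the value does not
    depend on the base point. *)
Lemma heap_brace (b c d : L) :
  heap_op (heap_op c a (heap_op a b a)) a d = heap_op c b d.
Proof. by rewrite !heap_assoc heap_left -heap_assoc heap_right. Qed.

End HeapGroup.

Lemma star_inj (G : groupoid) (l : vert G) (x y : star l) :
  sval x = sval y -> x = y.
Proof.
case: x y => [x hx] [y hy] /= exy; subst y.
by rewrite (proof_irrelevance _ hx hy).
Qed.

(** Transport between stars at equal but not convertible vertices. It keeps the underlying arrow, so
    [star_inj] sees through it. *)
Definition star_cast (G : groupoid) (l l' : vert G) (e : l = l') (x : star l) :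
    star l' :=
  exist _ (sval x) (etrans (svalP x) e).

Lemma star_cast_inj (G : groupoid) (l l' : vert G) (e : l = l') :
  injective (@star_cast G l l' e).
Proof. by move=> x y /(congr1 sval) /= exy; apply: star_inj. Qed.

Lemma star_cast_op (G : groupoid) (add : star_op G) (l l' : vert G)
    (e : l = l') (x y : star l) :
  star_cast e (add l x y) = add l' (star_cast e x) (star_cast e y).
Proof.
by subst l'; rewrite [LHS](@star_inj _ _ _ (add l x y)) //;
  congr add; apply: star_inj.
Qed.

Lemma mul_invK (G : groupoid) (a x : arr G) (h : tgt a = src x)
    (h' : tgt (inv_arr a) = src (mul a x h)) :
  mul (inv_arr a) (mul a x h) h' = x.
Proof.
have hl : tgt (mul (inv_arr a) a (tgt_inv a)) = src x by rewrite tgt_mul.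
rewrite -(mul_assoc hl h') -[RHS](mul_unit_l (tgt_unit _)).
by apply: mul_congr => //; rewrite mul_inv_l h.
Qed.

Lemma mul_star_inj (G : groupoid) (a : arr G) : injective (@mul_star G a).
Proof.
move=> b c /(congr1 sval) /= ebc; apply: star_inj.
have hb := etrans (tgt_inv a) (esym (src_mul (esym (svalP b)))).
have hc := etrans (tgt_inv a) (esym (src_mul (esym (svalP c)))).
by rewrite -(mul_invK hb) -(mul_invK hc); apply: mul_congr.
Qed.

Section SemidirectStars.
Variables (G : groupoid) (L : Type) (act : coarse_action L G).

(** The remaining component, the source of the coarse arrow, is fixed by the star. *)
Lemma sd_star_ext (v : vert (semidirect act)) (x y : star v) :
  sd_star_arr x = sd_star_arr y -> sd_star_end x = sd_star_end y -> x = y.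
Proof.
move=> /(congr1 sval); case: v x y => l a [[g [b c]] hx] [[h [b' c']] hy] /=.
rewrite /sd_star_end /= => egh ecc; apply: star_inj => /=.
by move: hx hy => [_ eb] [_ eb']; rewrite egh ecc eb eb'.
Qed.

Lemma sd_star_arrK (l : vert G) (g : star l) (a b : L) :
  sd_star_arr (sd_star act g a b) = g.
Proof. exact: star_inj. Qed.

(** For [A] = g x [a, b] the target starts with [b, a]|>t(g), and acting by [a, b] undoes this. The
    equality is not definitional, hence the cast in [sd_star_arr_mul]. *)
Lemma act_tgt (A : arr (semidirect act)) :
  aut_vert (act A.2) (tgt A).1 = tgt A.1.
Proof. by case: A => g [a b]; rewrite /= act_vert_comp act_vert_id. Qed.

Lemma sd_star_arr_mul (A : arr (semidirect act)) (H : star (tgt A)) :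
  sd_star_arr (mul_star H) =
  mul_star (star_cast (act_tgt A) (aut_star (act A.2) (sd_star_arr H))).
Proof. by apply: star_inj; apply: mul_congr. Qed.

Lemma sd_star_arr_self (A : arr (semidirect act)) :
  sd_star_arr (self_star A) = self_star A.1.
Proof. exact: star_inj. Qed.

End SemidirectStars.

Section SemidirectAdd.
Variables (G : quiver_skew_brace) (L : heap) (act : coarse_action L G).

Lemma sd_star_arr_add (v : vert (semidirect act)) (x y : star v) :
  sd_star_arr (semidirect_add act v x y) =
  qsb_add G (sd_star_arr x) (sd_star_arr y).
Proof. by case: v x y => l a x y; apply: star_inj. Qed.

Lemma sd_star_end_add (v : vert (semidirect act)) (x y : star v) :
  sd_star_end (semidirect_add act v x y) =
  heap_op (sd_star_end x) v.2 (sd_star_end y).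
Proof. by case: v x y. Qed.

Section Opposites.
Variables (zero : forall l : vert G, star l) (opp : forall l : vert G, star l -> star l).
Arguments opp {l} _.
Hypothesis addG : forall l : vert G, group_laws (@qsb_add G l) (zero l) opp.
Hypothesis addB : forall (a : arr G) (b c : star (tgt a)),
  mul_star (qsb_add G b c) =
  qsb_add G (qsb_add G (mul_star b) (opp (self_star a))) (mul_star c).

Definition sd_zero (v : vert (semidirect act)) : star v :=
  match v return @star (semidirect act) v with
  | (l, a) => sd_star act (zero l) a a
  end.

Definition sd_opp (v : vert (semidirect act)) : star v -> star v :=
  match v return @star (semidirect act) v -> @star (semidirect act) v with
  | (l, a) => fun x =>
      sd_star act (opp (sd_star_arr x)) a (heap_op a (sd_star_end x) a)
  end.

(** The star at (l, a) is the direct product of the additive group at l and the retract of [L] at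
    a. *)
Lemma semidirect_group_laws (v : vert (semidirect act)) :
  group_laws (semidirect_add act v) (sd_zero v) (@sd_opp v).
Proof.
case: v => l a.
have [hA h0 hr0 hN hrN] := heap_group_laws a.
have [gA g0 gr0 gN grN] := addG l.
split=> [x y z|x|x|x|x]; apply: sd_star_ext;
  rewrite ?sd_star_arr_add ?sd_star_end_add ?sd_star_arrK.
- exact: gA.
- exact: hA.
- exact: g0.
- exact: h0.
- exact: gr0.
- exact: hr0.
- exact: gN.
- exact: hN.
- exact: grN.
- exact: hrN.
Qed.

(** The first projection is a group morphism, so it sends any choice of opposites, in particular one
    supplied by an existential, to [opp]. *)
Lemma sd_star_arr_opp (zero' : forall v : vert (semidirect act), star v)
    (opp' : forall v : vert (semidirect act), star v -> star v) v (x : star v) :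
  (forall v, group_laws (semidirect_add act v) (zero' v) (opp' v)) ->
  sd_star_arr (opp' v x) = opp (sd_star_arr x).
Proof.
move=> sdG.
exact: (group_morph_opp (sdG v) (addG v.1) (@sd_star_arr_add v)).
Qed.

(* The right-hand side is the first component of [A H - A + A K]. *)
Lemma sd_brace_arr (A : arr (semidirect act)) (H K : star (tgt A)) :
  sd_star_arr (mul_star (semidirect_add act (tgt A) H K)) =
  qsb_add G
    (qsb_add G (sd_star_arr (mul_star H)) (opp (self_star A.1)))
    (sd_star_arr (mul_star K)) <->
  aut_star (act A.2) (qsb_add G (sd_star_arr H) (sd_star_arr K)) =
  qsb_add G (aut_star (act A.2) (sd_star_arr H))
    (aut_star (act A.2) (sd_star_arr K)).
Proof.
rewrite !sd_star_arr_mul -addB -star_cast_op sd_star_arr_add.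
by split=> [/mul_star_inj /star_cast_inj | ->].
Qed.

End Opposites.

End SemidirectAdd.

Theorem proposition3p2 (G : quiver_skew_brace) (L : heap)
    (act : coarse_action L G) :
  is_quiver_skew_brace (semidirect_add act) <->
  is_module_algebra act (@qsb_add G).
Proof.
have [zero [opp [addG addB]]] := qsb_axioms G.
split=> [[zero' [opp' [sdG sdB]]] a b l h k | actD].
(* The unit is taken at [a, b]|>l, not at l, so that the target of [A] is (l, b) and h, k can be
   placed in the star there. *)
- pose A : arr (semidirect act) := (unit_arr (aut_vert (act (a, b)) l), (a, b)).
  have eA : (l, b) = tgt A :> vert (semidirect act).
    by rewrite /= /sd_tgt /= tgt_unit act_vert_comp act_vert_id.
  (* The end point b is arbitrary: only first components are compared. *)
  pose H := star_cast eA (sd_star act h b b).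
  pose K := star_cast eA (sd_star act k b b).
  have e := congr1 (@sd_star_arr _ _ _ _) (sdB A H K).
  rewrite !sd_star_arr_add (sd_star_arr_opp addG _ sdG) sd_star_arr_self in e.
  have {}e := proj1 (sd_brace_arr addB H K) e.
  have el : l = (tgt A).1 by rewrite -eA.
  have eH : sd_star_arr H = star_cast el h by apply: star_inj.
  have eK : sd_star_arr K = star_cast el k by apply: star_inj.
  rewrite eH eK -star_cast_op in e.
  (* The action commutes with casts, so all casts can be moved outside the sum and cancelled. *)
  have castE (x : star l) : aut_star (act (a, b)) (star_cast el x) =
      star_cast (congr1 (aut_vert (act (a, b))) el) (aut_star (act (a, b)) x).
    exact: star_inj.
  by move: e; rewrite !castE -star_cast_op => /star_cast_inj.
- exists (sd_zero zero), (sd_opp opp); split.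
    exact: semidirect_group_laws.
  move=> A H K; apply: sd_star_ext.
    rewrite !sd_star_arr_add.
    rewrite (sd_star_arr_opp addG _ (semidirect_group_laws addG)).
    rewrite sd_star_arr_self; apply/(sd_brace_arr addB).
    by case: (A) H K => g [a b] H K; exact: actD.
  (* Left multiplication by [A] keeps end points, and the opposite of [A] ends at <a, b, a>. *)
  rewrite !sd_star_end_add; case: A H K => g [a b] H K.
  by rewrite /sd_star_end /= heap_brace.
Qed.
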